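(* Let $\triangle(ABC)$ be a (non-degenerate) triangle in the Euclidean plane with edge lengths $a=|BC|$, $b=|AC|$, $c=|AB|$, and let $X$ be a point in the interior of $\triangle(ABC)$. Put $\psi_a=\angle(BXC)$, $\psi_b=\angle(CXA)$, $\psi_c=360^\circ-\psi_a-\psi_b$ (so $\psi_c=\angle(AXB)$), $c'=|CX|$, and $$\Theta^2=\sqrt{(a+b+c)(a+c-b)(b+c-a)(a+b-c)}.$$ Then $$(c')^2=\frac{\frac14\left((1-\cot\psi_a\cot\psi_b)\,\Theta^2-(\cot\psi_a+\cot\psi_b)(a^2+b^2-c^2)\right)^2}{\left(c^2+a^2\cot^2\psi_a+b^2\cot^2\psi_b\right)+\cot\psi_a\cot\psi_b\,(a^2+b^2-c^2)-(\cot\psi_a+\cot\psi_b)\,\Theta^2}$$ and, equivalently, $$(c')^2=\frac{\frac14\left(\cot\psi_a+\cot\psi_b\right)^2\left((a^2+b^2-c^2)-\Theta^2\cot\psi_c\right)^2}{a^2(1+\cot^2\psi_a)+b^2(1+\cot^2\psi_b)-(\cot\psi_a+\cot\psi_b)\left((a^2+b^2-c^2)\cot\psi_c+\Theta^2\right)}.$$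
   Context: Angles $\angle(BXC)$, $\angle(CXA)$, $\angle(AXB)$ are the ordinary unoriented angles at $X$; since $X$ is an interior point, each lies strictly between $0^\circ$ and $180^\circ$ and they sum to $360^\circ$. The symbol $\Theta^2$ denotes the nonnegative square root displayed in the claim (it equals four times the area of the triangle). *)

(* Defs.v *)
From mathcomp Require Import all_boot all_order all_algebra.
From mathcomp Require Import all_classical all_reals all_analysis.

Set Implicit Arguments.
Unset Strict Implicit.
Unset Printing Implicit Defensive.

Import Order.TTheory GRing.Theory Num.Theory.
Import numFieldNormedType.Exports.

Local Open Scope classical_set_scope.
Local Open Scope ring_scope.

(* The plane is 'rV[R]_2, and all metric notions derive from dotp, because the
   norm `|_| on 'rV[R]_2 is the supremum norm. The library topology
   on 'rV[R]_2 is nevertheless the Euclidean one. *)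
Definition dotp (R : realType) (u v : 'rV[R]_2) : R := (u *m v^T) 0 0.

Definition eucl_dist (R : realType) (P Q : 'rV[R]_2) : R :=
  Num.sqrt (dotp (P - Q) (P - Q)).

(* Unoriented angle PXQ in radians, in [0, pi]; meaningful for P, Q != X. *)
Definition angle (R : realType) (P X Q : 'rV[R]_2) : R :=
  acos (dotp (P - X) (Q - X) / (eucl_dist P X * eucl_dist Q X)).

Definition cot (R : realType) (x : R) : R := cos x / sin x.

Definition triangle (R : realType) (A B C : 'rV[R]_2) : set 'rV[R]_2 :=
  [set P | exists s t u : R, [/\ 0 <= s, 0 <= t, 0 <= u, s + t + u = 1 &
                                 P = s *: A + t *: B + u *: C]].

Definition nondegenerate_triangle (R : realType) (A B C : 'rV[R]_2) : Prop :=
  row_free (col_mx (B - A) (C - A)).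

(* Main.v *)
(* Put u = A - X, v = B - X, w = C - X, p = v x w, q = w x u, r = u x v. As X is
   interior, p, q and r have the same strict sign s, and p u + q v + r w = 0.
   Then cot psi_a = s (v.w) / p, cot psi_b = s (w.u) / q, and
   Theta^2 = 2 s (p + q + r), so with S = p |u|^2 + q |v|^2 + r |w|^2, which has
   sign s, the base of the squared numerator is 2 s |w|^2 S / (p q) and the
   denominator is |w|^2 (S / (p q))^2, nonzero. The second formula is the first
   one rewritten with (cot psi_a + cot psi_b) cot psi_c = 1 - cot psi_a cot psi_b. *)
Require Import Defs.
From mathcomp Require Import all_boot all_order all_algebra.
From mathcomp Require Import all_classical all_reals all_analysis.
From mathcomp Require Import ring lra.
Import Order.TTheory GRing.Theory Num.Theory.
Import numFieldNormedType.Exports.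
Local Open Scope classical_set_scope.
Local Open Scope ring_scope.

(** * Identities between dot and cross products in the plane *)

Definition cross {R : realType} (u v : 'rV[R]_2) : R :=
  u 0 0 * v 0 1 - u 0 1 * v 0 0.

Lemma dotpE (R : realType) (u v : 'rV[R]_2) :
  dotp u v = u 0 0 * v 0 0 + u 0 1 * v 0 1.
Proof.
rewrite /dotp mxE !big_ord_recl big_ord0 addr0 !mxE.
by congr (_ + u _ _ * v _ _); apply/val_inj.
Qed.

Lemma dotpC (R : realType) (u v : 'rV[R]_2) : dotp u v = dotp v u.
Proof. by rewrite !dotpE; ring. Qed.

Lemma dotp_ge0 (R : realType) (u : 'rV[R]_2) : 0 <= dotp u u.
Proof. by rewrite dotpE addr_ge0 // -expr2 sqr_ge0. Qed.

Lemma lagrange_identity (R : realType) (u v : 'rV[R]_2) :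
  dotp u v ^+ 2 + cross u v ^+ 2 = dotp u u * dotp v v.
Proof. by rewrite !dotpE /cross; ring. Qed.

(** With vectors read as complex numbers, [dotp u v] and [cross u v] are the real and imaginary
    parts of conj(u) v. This identity and [dotp_cross] are the two parts of conj(u) v conj(v) w =
    |v|^2 conj(u) w. *)
Lemma dotp_dotp (R : realType) (u v w : 'rV[R]_2) :
  dotp u v * dotp v w - cross u v * cross v w = dotp v v * dotp w u.
Proof. by rewrite !dotpE /cross; ring. Qed.

Lemma dotp_cross (R : realType) (u v w : 'rV[R]_2) :
  dotp u v * cross v w + dotp v w * cross u v = - (dotp v v * cross w u).
Proof. by rewrite !dotpE /cross; ring. Qed.

Lemma dotpBB (R : realType) (u v : 'rV[R]_2) :
  dotp (u - v) (u - v) = dotp u u + dotp v v - 2 * dotp u v.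
Proof. by rewrite !dotpE !mxE; ring. Qed.

Lemma dotp_sub (R : realType) (P Q Y : 'rV[R]_2) :
  dotp (P - Q) (P - Q) =
  dotp (P - Y) (P - Y) + dotp (Q - Y) (Q - Y) - 2 * dotp (P - Y) (Q - Y).
Proof. by rewrite -dotpBB opprB addrA subrK. Qed.

Lemma dotp_gt0 (R : realType) (u v : 'rV[R]_2) :
  cross u v != 0 -> (0 < dotp u u) && (0 < dotp v v).
Proof.
move=> uv0; have : dotp u u * dotp v v != 0.
  rewrite -lagrange_identity gt_eqF // ltr_wpDl ?sqr_ge0 //.
  by rewrite exprn_even_gt0.
by rewrite mulf_eq0 negb_or !lt0r !dotp_ge0 !andbT.
Qed.

Lemma eucl_dist_sqr (R : realType) (P Q : 'rV[R]_2) :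
  eucl_dist P Q ^+ 2 = dotp (P - Q) (P - Q).
Proof. by rewrite /eucl_dist sqr_sqrtr ?dotp_ge0. Qed.

Lemma eucl_dist_gt0 (R : realType) (P Q : 'rV[R]_2) :
  0 < dotp (P - Q) (P - Q) -> 0 < eucl_dist P Q.
Proof. by move=> ?; rewrite /eucl_dist sqrtr_gt0. Qed.

(** * Cosine, sine and cotangent of an unoriented angle *)

Section Angle.
Variables (R : realType) (P X Q : 'rV[R]_2).
Hypothesis PXQ : cross (P - X) (Q - X) != 0.
Let d := eucl_dist P X * eucl_dist Q X.

Let d_gt0 : 0 < d.
Proof.
by have /andP[? ?] := dotp_gt0 _ _ _ PXQ; rewrite mulr_gt0 ?eucl_dist_gt0.
Qed.

(** Lagrange's identity divided by [d ^+ 2]. It yields both the range condition for [acos] and the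
    value of the sine. *)
Let cosine_sqr :
  1 - (dotp (P - X) (Q - X) / d) ^+ 2 = (`|cross (P - X) (Q - X)| / d) ^+ 2.
Proof.
have d0 : d != 0 by rewrite gt_eqF.
rewrite !expr_div_n real_normK ?num_real //.
apply: (mulIf (expf_neq0 2 d0)); rewrite mulrBl mul1r !divfK ?expf_neq0 //.
by rewrite exprMn !eucl_dist_sqr -lagrange_identity; ring.
Qed.

Let cosine_itv : -1 <= dotp (P - X) (Q - X) / d <= 1.
Proof.
by rewrite -ler_norml -[leRHS]normr1 -ler_sqr ?nnegrE // -subr_ge0 !real_normK
  ?num_real // expr1n cosine_sqr sqr_ge0.
Qed.

Lemma cos_angle :
  cos (angle P X Q) = dotp (P - X) (Q - X) / (eucl_dist P X * eucl_dist Q X).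
Proof. by rewrite /angle acosK. Qed.

Lemma sin_angle :
  sin (angle P X Q) = `|cross (P - X) (Q - X)| / (eucl_dist P X * eucl_dist Q X).
Proof.
rewrite /angle sin_acos // cosine_sqr sqrtr_sqr ger0_norm //.
by rewrite divr_ge0 // ltW.
Qed.

Lemma angle_itv : 0 <= angle P X Q <= pi.
Proof. by rewrite /angle acos_ge0 // acos_lepi. Qed.

Lemma cot_angle :
  cot (angle P X Q) = dotp (P - X) (Q - X) / `|cross (P - X) (Q - X)|.
Proof.
rewrite /cot cos_angle sin_angle -/d; field.
by rewrite normr_eq0 PXQ gt_eqF.
Qed.
End Angle.

(** * Signed areas in a non-degenerate triangle *)

Lemma nondegenerate_cross (R : realType) (A B C : 'rV[R]_2) :
  nondegenerate_triangle A B C -> cross (B - A) (C - A) != 0.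
Proof.
rewrite /nondegenerate_triangle.
set b := B - A; set c := C - A; set M := col_mx b c.
have Mb j : M 0 j = b 0 j.
  by rewrite -(col_mxEu b c); congr (M _ j); apply: val_inj.
have Mc j : M (lift 0 0) j = c 0 j.
  by rewrite -(col_mxEd b c); congr (M _ j); apply: val_inj.
(* Only the entries of [M] are kept; its 1 + 1 rows are read as 2, which makes it square with
   determinant [cross b c]. *)
clearbody M; rewrite (row_free_unit (M : 'M[R]_2)) unitmxE unitfE (expand_det_row _ 0).
rewrite !big_ord_recl big_ord0 /cofactor !det_mx11 !mxE !Mb !Mc /=.
rewrite (_ : lift (lift ord0 ord0) 0 = 0); last exact: val_inj.
rewrite (_ : lift 0 0 = 1); last exact: val_inj.
by rewrite addn0 add0n expr0 expr1 /cross; congr (_ != _); ring.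
Qed.

(** The ratio of the two cross products is the barycentric coordinate of [P] at [A]. *)
Lemma cross_triangle (R : realType) (A B C P : 'rV[R]_2) :
  triangle A B C P ->
  0 <= cross (B - P) (C - P) * cross (B - A) (C - A).
Proof.
move=> [s [t [u [s0 t0 u0 stu ->]]]].
set T := cross (B - A) (C - A).
suff -> : cross (B - (s *: A + t *: B + u *: C)) (C - (s *: A + t *: B + u *: C))
          = s * T by rewrite -mulrA mulr_ge0 // -expr2 sqr_ge0.
have -> : s = 1 - t - u by rewrite -stu; ring.
by rewrite /T /cross !mxE; ring.
Qed.

Lemma triangle_rot (R : realType) (A B C : 'rV[R]_2) :
  triangle A B C = triangle B C A.
Proof.
apply/seteqP; split => P.
  move=> [s [t [u [? ? ? stu ->]]]]; exists t, u, s; split=> //; first lra.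
  by rewrite -!addrA addrC addrA.
move=> [s [t [u [? ? ? stu ->]]]]; exists u, s, t; split=> //; first lra.
by rewrite addrC addrA.
Qed.

Lemma cross_interior (R : realType) (A B C X : 'rV[R]_2) :
  cross (B - A) (C - A) != 0 -> (triangle A B C)° X ->
  0 < cross (B - X) (C - X) * cross (B - A) (C - A).
Proof.
set T := cross (B - A) (C - A) => T0 Xint.
(* Stepping from X slightly away from A stays in the triangle, which keeps the
   barycentric coordinate of X at A away from 0. *)
have cvgX : (fun e : R => X + e *: (X - A)) @ 0 --> X.
  rewrite -[Y in _ --> Y]addr0 -(scale0r (X - A)).
  by apply: cvgD; [exact: cvg_cst|apply: cvgZr_tmp; exact: cvg_id].
have /nbhs_ballP[e /= e0 /(_ (e / 2))] := cvgX _ Xint.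
have e20 : 0 < e / 2 by rewrite divr_gt0.
rewrite /ball /= sub0r normrN gtr0_norm // => /(_ _)/cross_triangle.
rewrite -/T => H.
have {}H := H ltac:(lra).
(* The barycentric coordinate at [A] is affine and equals 1 at [A], so at the shifted point it is 1
   + e/2 times that of [X], minus e/2. As this is nonnegative, the coordinate of [X] is positive. *)
have E : cross (B - (X + e / 2 *: (X - A))) (C - (X + e / 2 *: (X - A))) =
  (1 + e / 2) * cross (B - X) (C - X) - e / 2 * T.
  by rewrite /T /cross !mxE; ring.
rewrite -(pmulr_rgt0 _ (_ : 0 < 1 + e / 2)); last by lra.
rewrite mulrA -[ltRHS](subrK (e / 2 * T * T)) -mulrBl -E ltr_wpDl //.
by rewrite -mulrA mulr_gt0 // -expr2 exprn_even_gt0.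
Qed.

(** With the law of cosines at [A], Heron's product becomes 4 (|B - A|^2 |C - A|^2 - ((B - A).(C -
    A))^2), which Lagrange's identity turns into a square. *)
Lemma heron_cross (R : realType) (A B C : 'rV[R]_2) :
  let a := eucl_dist B C in
  let b := eucl_dist A C in
  let c := eucl_dist A B in
  Num.sqrt ((a + b + c) * (a + c - b) * (b + c - a) * (a + b - c)) =
  2 * `|cross (B - A) (C - A)|.
Proof.
move=> a b c.
have -> : (a + b + c) * (a + c - b) * (b + c - a) * (a + b - c) =
    4 * a ^+ 2 * b ^+ 2 - (a ^+ 2 + b ^+ 2 - c ^+ 2) ^+ 2 by ring.
have cross_sqr :=
  etrans (addrC _ _) (lagrange_identity _ (B - A) (C - A)).
rewrite -[2 in RHS]gtr0_norm // -normrM -sqrtr_sqr exprMn.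
rewrite -(addrK (dotp (B - A) (C - A) ^+ 2) (cross _ _ ^+ 2)) cross_sqr.
have -> : b ^+ 2 = dotp (C - A) (C - A).
  by rewrite eucl_dist_sqr -opprB !dotpE !mxE; ring.
have -> : c ^+ 2 = dotp (B - A) (B - A).
  by rewrite eucl_dist_sqr -opprB !dotpE !mxE; ring.
by rewrite eucl_dist_sqr (dotp_sub _ _ _ A); congr Num.sqrt; ring.
Qed.

(** The witness [s] is the sign of [T]. Cyclic relabelling preserves both the triangle and [T], so
    [cross_interior] applies at each vertex. *)
Lemma interior_orientation (R : realType) (A B C X : 'rV[R]_2) :
  nondegenerate_triangle A B C -> (triangle A B C)° X ->
  exists2 s : R, s = 1 \/ s = -1 &
    [/\ `|cross (B - A) (C - A)| = s * cross (B - A) (C - A),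
        0 < s * cross (B - X) (C - X), 0 < s * cross (C - X) (A - X)
      & 0 < s * cross (A - X) (B - X)].
Proof.
move=> /nondegenerate_cross; set T := cross (B - A) (C - A) => T0 Xint.
have T_BC : cross (C - B) (A - B) = T by rewrite /T /cross !mxE; ring.
have T_CA : cross (A - C) (B - C) = T by rewrite /T /cross !mxE; ring.
have pos (p : R) : 0 < p * T -> 0 < Num.sg T * p.
  by rewrite mulrC -!sgr_cp0 !sgrM sgr_id.
exists (Num.sg T); last split.
- by case: sgrP T0 => //; [left|right].
- by rewrite normrEsg.
- by apply: pos; exact: cross_interior.
- apply: pos; rewrite -T_BC; apply: cross_interior; first by rewrite T_BC.
  by rewrite -triangle_rot.
- apply: pos; rewrite -T_CA; apply: cross_interior; first by rewrite T_CA.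
  by rewrite triangle_rot.
Qed.

(** * The angles at an interior point, with [s] the common orientation *)

Section InteriorPoint.
Variables (R : realType) (A B C X : 'rV[R]_2) (s : R).
Hypothesis s1 : s = 1 \/ s = -1.
Hypotheses (sp : 0 < s * cross (B - X) (C - X))
  (sq : 0 < s * cross (C - X) (A - X)) (sr : 0 < s * cross (A - X) (B - X)).

Let norm_s (x : R) : 0 < s * x -> `|x| = s * x.
Proof.
by move=> /gtr0_norm <-; case: s1 => ->;
   rewrite ?mulN1r ?normrN ?mul1r.
Qed.

Let neq0_s (x : R) : 0 < s * x -> x != 0.
Proof. by apply: contraTneq => ->; rewrite mulr0 ltxx. Qed.

Let ww_gt0 : 0 < dotp (C - X) (C - X).
Proof. by have /andP[] := dotp_gt0 _ _ _ (neq0_s _ sq). Qed.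

Let sqr_s : s ^+ 2 = 1.
Proof. by case: s1 => ->; rewrite ?sqrrN expr1n. Qed.

(** The sum of the first two angles has the cosine of the third and a negative sine, so it lies in
    [pi, 2 pi]. Its complement to 2 pi then lies in [0, pi], where the cosine is injective. *)
Lemma sum_angles : 2 * pi - angle B X C - angle C X A = angle A X B.
Proof.
have p0 := neq0_s _ sp; have q0 := neq0_s _ sq; have r0 := neq0_s _ sr.
have /andP[a0 api] := angle_itv _ _ _ _ p0.
have /andP[b0 bpi] := angle_itv _ _ _ _ q0.
have /andP[/eucl_dist_gt0 AX /eucl_dist_gt0 BX] := dotp_gt0 _ _ _ r0.
have CX := eucl_dist_gt0 _ _ _ ww_gt0.
have cosab : cos (angle B X C + angle C X A) = cos (angle A X B).
  rewrite cosD !cos_angle // !sin_angle // !norm_s //.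
  have -> : dotp (A - X) (B - X) / (eucl_dist A X * eucl_dist B X) =
     dotp (C - X) (C - X) * dotp (A - X) (B - X) /
     (eucl_dist A X * eucl_dist B X * eucl_dist C X ^+ 2).
    by rewrite eucl_dist_sqr; field; rewrite !gt_eqF.
  have -> : dotp (C - X) (C - X) * dotp (A - X) (B - X) =
      dotp (B - X) (C - X) * dotp (C - X) (A - X) -
      s ^+ 2 * (cross (B - X) (C - X) * cross (C - X) (A - X)).
    by rewrite sqr_s mul1r dotp_dotp.
  by field; rewrite !gt_eqF.
have sinab : sin (angle B X C + angle C X A) < 0.
  rewrite sinD !cos_angle // !sin_angle // !norm_s //.
  have -> : s * cross (B - X) (C - X) / (eucl_dist B X * eucl_dist C X) *
      (dotp (C - X) (A - X) / (eucl_dist C X * eucl_dist A X)) +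
      dotp (B - X) (C - X) / (eucl_dist B X * eucl_dist C X) *
      (s * cross (C - X) (A - X) / (eucl_dist C X * eucl_dist A X)) =
      - (s * cross (A - X) (B - X) / (eucl_dist A X * eucl_dist B X)).
    have -> : cross (A - X) (B - X) =
        - (dotp (B - X) (C - X) * cross (C - X) (A - X) +
           dotp (C - X) (A - X) * cross (B - X) (C - X)) / eucl_dist C X ^+ 2.
      by rewrite eucl_dist_sqr dotp_cross opprK mulrC mulKf ?gt_eqF.
    by field; rewrite !gt_eqF.
  by rewrite oppr_lt0 divr_gt0 // mulr_gt0.
have pi_le : pi <= angle B X C + angle C X A.
  rewrite leNgt; apply/negP => ltpi; move: sinab.
  by rewrite ltNge sin_ge0_pi // addr_ge0 //= ltW.
rewrite -(cosK (x := angle A X B)) ?in_itv /= ?angle_itv // -cosab.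
rewrite -cosN -cosD2pi cosK ?in_itv /=; first by ring.
by apply/andP; split; lra.
Qed.

(** * Cotangent relations and the distance formula *)

Let E := eucl_dist B C ^+ 2 + eucl_dist A C ^+ 2 - eucl_dist A B ^+ 2.
Let Theta2 := 2 * (s * cross (B - A) (C - A)).
Let cota := cot (angle B X C).
Let cotb := cot (angle C X A).

Let cot_s (P Y Q : 'rV[R]_2) : 0 < s * cross (P - Y) (Q - Y) ->
  cot (angle P Y Q) = s * dotp (P - Y) (Q - Y) / cross (P - Y) (Q - Y).
Proof.
move=> c0; rewrite cot_angle ?neq0_s // norm_s //.
have := neq0_s _ c0; case: s1 => -> ?; field => //.
Qed.

(** Vector form of sin(psi_a + psi_b) / (sin psi_a sin psi_b); [cot_mul] is likewise - cos(psi_a +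
    psi_b) over the same product. *)
Let cot_add :
  cota + cotb = s * - (dotp (C - X) (C - X) * cross (A - X) (B - X)) /
                (cross (B - X) (C - X) * cross (C - X) (A - X)).
Proof.
rewrite -dotp_cross /cota /cotb !cot_s //.
by field; rewrite !neq0_s.
Qed.

Let cot_mul :
  1 - cota * cotb = - (dotp (C - X) (C - X) * dotp (A - X) (B - X)) /
                    (cross (B - X) (C - X) * cross (C - X) (A - X)).
Proof.
rewrite -dotp_dotp /cota /cotb !cot_s //.
by field: sqr_s; rewrite !neq0_s.
Qed.

Lemma cot_angles :
  (cota + cotb) * cot (angle A X B) = 1 - cota * cotb.
Proof.
rewrite cot_add cot_mul cot_s //.
by field: sqr_s; rewrite !neq0_s.
Qed.

Lemma first_formula :
  eucl_dist C X ^+ 2 =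
    4^-1 * ((1 - cota * cotb) * Theta2 - (cota + cotb) * E) ^+ 2
    / ((eucl_dist A B ^+ 2 + eucl_dist B C ^+ 2 * cota ^+ 2
        + eucl_dist A C ^+ 2 * cotb ^+ 2)
       + cota * cotb * E - (cota + cotb) * Theta2).
Proof.
have ThetaE : Theta2 = 2 * s * (cross (B - X) (C - X) + cross (C - X) (A - X)
                                + cross (A - X) (B - X)).
  by rewrite /Theta2 /cross !mxE; ring.
have caE : cota = s * dotp (B - X) (C - X) / cross (B - X) (C - X) by exact: cot_s.
have cbE : cotb = s * dotp (C - X) (A - X) / cross (C - X) (A - X) by exact: cot_s.
have p0 := neq0_s _ sp; have q0 := neq0_s _ sq; have W0 := lt0r_neq0 ww_gt0.
move: sp sq sr p0 q0 W0 cot_add cot_mul ThetaE caE cbE; rewrite /E !eucl_dist_sqr.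
rewrite (dotp_sub _ B C X) (dotp_sub _ A C X) (dotp_sub _ A B X).
rewrite (dotpC _ (A - X) (C - X)).
set u := A - X; set v := B - X; set w := C - X.
have := (lagrange_identity _ v w, lagrange_identity _ w u, lagrange_identity _ u v).
have := (dotp_dotp _ v w u, dotp_dotp _ w u v, dotp_dotp _ u v w).
have := (dotp_cross _ v w u, dotp_cross _ w u v, dotp_cross _ u v w).
have := (dotp_ge0 _ u, dotp_ge0 _ v, dotp_ge0 _ w).
(* The vectors are now replaced by their nine dot and cross products, and the rest is algebra modulo
   the identities collected above. *)
move: (cross v w) (cross w u) (cross u v) => p q r.
move: (dotp v w) (dotp w u) (dotp u v) => al be ga.
move: (dotp u u) (dotp v v) (dotp w w) => U V W.
move: cota cotb Theta2 => ca cb T.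
move=> [[U0 V0] W_ge0] [[ccW ccU] ccV] [[ddW ddU] ddV] [[lp lq] lr].
move=> sp' sq' sr' p0 q0 W0 caddE cmulE -> caE cbE.
pose S := U * p + V * q + W * r.
have S0 : S != 0.
  apply: neq0_s; have -> : s * S = U * (s * p) + V * (s * q) + W * (s * r).
    by rewrite /S; ring.
  rewrite ltr_wpDl ?(pmulr_rgt0 _ (_ : 0 < W)) // ?lt0r ?W0 //.
  by rewrite addr_ge0 // mulr_ge0 // ltW.
have ca2 : 1 + ca ^+ 2 = V * W / p ^+ 2 by rewrite -lp caE; field: sqr_s.
have cb2 : 1 + cb ^+ 2 = W * U / q ^+ 2 by rewrite -lq cbE; field: sqr_s.
have N : (1 - ca * cb) * (2 * s * (p + q + r)) -
    (ca + cb) * (V + W - 2 * al + (U + W - 2 * be) - (U + V - 2 * ga)) =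
    2 * s * W * S / (p * q).
  (* The relation p u + q v + r w = 0, dotted with u and with v, replaces U p and V q. *)
  have -> : S = - (be * r + ga * q) - (ga * p + al * r) + W * r.
    by rewrite ccU ccV !opprK.
  by rewrite cmulE caddE; field; rewrite p0 q0.
(* The left side is the denominator of the formula multiplied by (p q)^2 / W. *)
have Ssqr : V * (V + W - 2 * al) * q ^+ 2 + U * (U + W - 2 * be) * p ^+ 2 +
    2 * (p * q) * (ga * (ga - al - be + W) + r * (p + q + r)) = S ^+ 2.
  have -> : S = q * (V - al) + p * (U - be).
    by rewrite /S -[W * r]opprK -ccW; ring.
  apply/eqP; rewrite -subr_eq0; apply/eqP.
  (* The difference is an explicit combination of six expressions, each zero by [lagrange_identity]
     or [dotp_dotp]. *)
  transitivity (q ^+ 2 * (V * W - (al ^+ 2 + p ^+ 2)) +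
    p ^+ 2 * (W * U - (be ^+ 2 + q ^+ 2)) +
    2 * (p * q) * ((ga ^+ 2 + r ^+ 2 - U * V) - (al * be - p * q - W * ga) -
      (be * ga - q * r - U * al) - (ga * al - r * p - V * be))); first by ring.
  by rewrite lp lq lr ddW ddU ddV !subrr !mulr0 !addr0.
have D : U + V - 2 * ga + (V + W - 2 * al) * ca ^+ 2 +
    (U + W - 2 * be) * cb ^+ 2 +
    ca * cb * (V + W - 2 * al + (U + W - 2 * be) - (U + V - 2 * ga)) -
    (ca + cb) * (2 * s * (p + q + r)) = W * S ^+ 2 / (p * q) ^+ 2.
  (* Writing c^2 as a^2 + b^2 - (a^2 + b^2 - c^2) leaves the cotangents only in the combinations
     evaluated by [ca2], [cb2], [cmulE] and [caddE]. *)
  transitivity ((V + W - 2 * al) * (1 + ca ^+ 2) +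
    (U + W - 2 * be) * (1 + cb ^+ 2) -
    (1 - ca * cb) * (2 * (ga - al - be + W)) -
    (ca + cb) * (2 * s * (p + q + r))); first by ring.
  rewrite ca2 cb2 cmulE caddE -Ssqr.
  by field: sqr_s; rewrite p0 q0.
rewrite N D.
by field: sqr_s; rewrite p0 q0 W0 S0.
Qed.

End InteriorPoint.

Theorem proposition12 (R : realType) (A B C X : 'rV[R]_2)
    (ABC_nondegenerate : nondegenerate_triangle A B C)
    (X_interior : (triangle A B C)° X) :
  let a := eucl_dist B C in
  let b := eucl_dist A C in
  let c := eucl_dist A B in
  let psi_a := angle B X C in
  let psi_b := angle C X A in
  let psi_c := 2 * pi - psi_a - psi_b in
  let c' := eucl_dist C X in
  let Theta2 :=
    Num.sqrt ((a + b + c) * (a + c - b) * (b + c - a) * (a + b - c)) in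
  [/\ psi_c = angle A X B,
      c' ^+ 2 =
        4^-1 * ((1 - cot psi_a * cot psi_b) * Theta2
                - (cot psi_a + cot psi_b) * (a ^+ 2 + b ^+ 2 - c ^+ 2)) ^+ 2
        / ((c ^+ 2 + a ^+ 2 * cot psi_a ^+ 2 + b ^+ 2 * cot psi_b ^+ 2)
           + cot psi_a * cot psi_b * (a ^+ 2 + b ^+ 2 - c ^+ 2)
           - (cot psi_a + cot psi_b) * Theta2)
    & c' ^+ 2 =
        4^-1 * (cot psi_a + cot psi_b) ^+ 2
             * ((a ^+ 2 + b ^+ 2 - c ^+ 2) - Theta2 * cot psi_c) ^+ 2
        / (a ^+ 2 * (1 + cot psi_a ^+ 2) + b ^+ 2 * (1 + cot psi_b ^+ 2)
           - (cot psi_a + cot psi_b)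
             * ((a ^+ 2 + b ^+ 2 - c ^+ 2) * cot psi_c + Theta2))].
Proof.
have [s s1 [normT sp sq sr]] :=
  interior_orientation _ _ _ _ _ ABC_nondegenerate X_interior.
have psi_cE := sum_angles _ _ _ _ _ _ s1 sp sq sr.
have cots := cot_angles _ _ _ _ _ _ s1 sp sq sr.
have formula := first_formula _ _ _ _ _ _ s1 sp sq sr.
move=> a b c psi_a psi_b psi_c c' Theta2.
rewrite /Theta2 heron_cross normT; split=> //.
rewrite /psi_c psi_cE formula -/a -/b -/c -/psi_a -/psi_b.
set ca := cot psi_a in cots *; set cb := cot psi_b in cots *.
set cc := cot _ in cots *; set E := a ^+ 2 + b ^+ 2 - c ^+ 2.
set T := 2 * (s * _).
congr (_ / _).
  (* By [cots] the first base is (ca + cb) (cc T - E); the opposite sign in the second formula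
     vanishes in the square. *)
  rewrite -cots -mulrA -exprMn -sqrrN; congr (_ * _ ^+ 2); ring.
have -> : (ca + cb) * (E * cc + T) = (ca + cb) * cc * E + (ca + cb) * T by ring.
by rewrite cots /E; ring.
Qed.
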